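(* Let $\lambda<\kappa$ be infinite cardinals with $\kappa$ uncountable, let $\{A(k):k\in\mathbb Z\}$ be a partition of $\kappa$ into pairwise disjoint sets of cardinality $\kappa$, and for each $k\in\mathbb Z$ let $I(k,\lambda)$ be a proper $\lambda^+$-complete ideal on $A(k)$ containing all singletons. Let $X=\kappa^2$ carry the topology $\mathcal T$ and let $X^*=X\cup\{-\infty,+\infty\}$ be its two-point extension, both defined in the context. Then the space $X^*$ is regular and not completely regular, and the same holds for its subspaces $X^*\setminus\{+\infty\}$ and $X^*\setminus\{-\infty\}$. Moreover, if $f:X^*\to\mathbb R$ is a continuous function, then $f(+\infty)=f(-\infty)$.
   Context: Regular and completely regular spaces are assumed to be $T_1$. An ideal is $\lambda^+$-complete if it is closed under unions of at most $\lambda$ of its members; hence $H\in I(k,\lambda)$ whenever $H\subseteq A(k)$ and $|H|\leqslant\lambda$. Put $\Delta=\{(x,x):x\in\kappa\}$ and $\Delta(k)=\Delta\cap A(k)^2$. The topology $\mathcal T$ on $X=\kappa^2$ is generated by the base consisting of all singletons $\{a\}$ with $a\in\kappa^2\setminus\Delta$ and all sets $$\Gamma(x,G,F)=\{(x,x)\}\cup\big(\{x\}\times(A(k-1)\setminus G)\big)\cup\big((A(k+1)\setminus F)\times\{x\}\big),$$ where $k\in\mathbb Z$, $x\in A(k)$, $|G|<\lambda$ and $F\in I(k+1,\lambda)$. The points $+\infty,-\infty$ are distinct and do not belong to $X$. In $X^*=X\cup\{-\infty,+\infty\}$, open sets of $X$ are open; the sets $\mathcal V^+_m=\{+\infty\}\cup\bigcup\{A(n)\times\kappa:n>m\}$,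 $m\in\mathbb Z$, form a base at $+\infty$; and the sets $\mathcal V^-_m=\{-\infty\}\cup\big(\bigcup\{A(n)\times\kappa:n\leqslant m\}\setminus\Delta(m)\big)$, $m\in\mathbb Z$, form a base at $-\infty$. *)

(* Defs.v *)
From HB Require Import structures.
From mathcomp Require Import all_boot all_order all_algebra.
From mathcomp Require Import all_classical all_reals all_analysis.
From mathcomp Require Import zify.
Import numFieldNormedType.Exports.
Set Implicit Arguments. Unset Strict Implicit. Unset Printing Implicit Defensive.
Import Order.TTheory GRing.Theory Num.Theory.
Local Open Scope classical_set_scope.
Local Open Scope card_scope.
Local Open Scope ring_scope.

(* The cardinals lambda < kappa are given by types L and K of those
   cardinalities; only the size of kappa matters in the construction, so
   |G| < lambda reads G #< [set: L] and |H| <= lambda reads H #<= [set: L]. *)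

Definition card_lt T U (A : set T) (B : set U) := A #<= B /\ ~ (B #<= A).
Notation "A '#<' B" := (card_lt A B) (at level 79) : card_scope.

Lemma rel_card_le T U (A : set T) (B : set U) (r : T -> U -> Prop) :
  (forall x, A x -> exists2 y, B y & r x y) ->
  (forall x x' y, A x -> A x' -> r x y -> r x' y -> x = x') -> A #<= B.
Proof.
have [[y0]|U0] := pselect (inhabited U); last first.
  move=> tot _; suff -> : A = set0 by exact: card_ge0.
  by rewrite -subset0 => x /tot[y]; case: U0.
pose pU : pointedType := HB.pack U (gen_eqMixin U) (gen_choiceMixin U) (isPointed.Build U y0).
move=> tot inj.
have /choice[f fP] : forall x, exists y : U, A x -> B y /\ r x y.
  move=> x; have [/tot[y By rxy]|nAx] := pselect (A x); first by exists y.
  by exists y0.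
apply/(@pcard_leP T pU)/injfunPex; exists f; first by move=> x /fP[].
move=> x x' /set_mem Ax /set_mem Ax' e; apply: (inj _ _ (f x)) => //.
  by have [] := fP _ Ax.
by rewrite e; have [] := fP _ Ax'.
Qed.

Lemma card_le_rel T U (A : set T) (B : set U) : A #<= B ->
  exists r : T -> U -> Prop,
  [/\ forall x, A x -> exists2 y, B y & r x y,
      forall x x' y, r x y -> r x' y -> x = x',
      forall x y y', r x y -> r x y' -> y = y' &
      forall x y, r x y -> A x /\ B y].
Proof.
move=> /card_leP[f].
pose r x y := exists a : set_type A, set_val a = x /\ set_val (f a) = y.
exists r; split.
- move=> x Ax; have ax : x \in A by exact: mem_set.
  exists (set_val (f (SigSub ax))); first by apply: set_mem; exact: valP.
  by exists (SigSub ax).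
- move=> x x' y [a [<- <-]] [a' [<- e]].
  suff -> : a' = a by [].
  by apply: (@inj _ _ _ f); rewrite ?inE//; exact: val_inj.
- by move=> x y y' [a [<- <-]] [a' [/val_inj -> <-]].
- by move=> x y [a [<- <-]]; split; apply: set_mem; exact: valP.
Qed.

Lemma card_le_total T U (A : set T) (B : set U) : A #<= B \/ B #<= A.
Proof.
pose P (g : set (T * U)) := [/\ g `<=` A `*` B,
  forall x x' y, g (x, y) -> g (x', y) -> x = x' &
  forall x y y', g (x, y) -> g (x, y') -> y = y'].
have [F FP Ftot|g [[gAB ginj gfun] gmax]] := @Zorn_bigcup _ P.
  have FF p q : (\bigcup_(X in F) X) p -> (\bigcup_(X in F) X) q ->
      exists2 X, F X & X p /\ X q.
    move=> [X FX Xp] [Y FY Yq].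
    by have [s|s] := Ftot _ _ FX FY; [exists Y|exists X] => //; split=> //; exact: s.
  split.
  - by move=> p [X FX Xp]; have [+ _ _] := FP _ FX; apply.
  - move=> x x' y Hx Hx'; have [X FX [Xx Xx']] := FF _ _ Hx Hx'.
    by have [_ H _] := FP _ FX; exact: H Xx Xx'.
  - move=> x x' y Hx Hx'; have [X FX [Xx Xx']] := FF _ _ Hx Hx'.
    by have [_ _ H] := FP _ FX; exact: H Xx Xx'.
have [domA|/existsNP[a /not_implyP[Aa na]]] :=
    pselect (forall x, A x -> exists y, g (x, y)).
  left; apply: (@rel_card_le _ _ _ _ (fun x y => g (x, y))) => [x /domA[y gxy]|].
    by exists y => //; have [] := gAB _ gxy.
  by move=> x x' y _ _; exact: ginj.
have [ranB|/existsNP[b /not_implyP[Bb nb]]] :=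
    pselect (forall y, B y -> exists x, g (x, y)).
  right; apply: (@rel_card_le _ _ _ _ (fun y x => g (x, y))) => [y /ranB[x gxy]|].
    by exists x => //; have [] := gAB _ gxy.
  by move=> y y' x _ _; exact: gfun.
exfalso; apply: (gmax (g `|` [set (a, b)])).
  split; first by move=> ? ?; left.
  by move=> /(_ (a, b)) H; apply: na; exists b; apply: H; right.
split.
- by move=> [x y] [/gAB//|[-> ->]].
- move=> x x' y [gx|ex] [gx'|ex']; first exact: ginj gx gx'.
  + by exfalso; apply: nb; exists x; case: ex' => _ <-.
  + by exfalso; apply: nb; exists x'; case: ex => _ <-.
  + by case: ex => -> _; case: ex' => -> _.
- move=> x y y' [gx|ex] [gx'|ex']; first exact: gfun gx gx'.
  + by exfalso; apply: na; exists y; case: ex' => <- _.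
  + by exfalso; apply: na; exists y'; case: ex => <- _.
  + by case: ex => _ ->; case: ex' => _ ->.
Qed.

(* Zorn on injections D * bool -> D with D included in A, as graphs. *)
Lemma card_setX_bool T (A : set T) : infinite_set A ->
  A `*` [set: bool] #<= A.
Proof.
move=> Ainf.
pose dom (g : set ((T * bool) * T)) := [set x | exists b y, g ((x, b), y)].
pose P (g : set ((T * bool) * T)) := [/\
  forall x b y, g ((x, b), y) -> A x /\ (forall b', exists y', g ((x, b'), y')),
  forall x b y, g ((x, b), y) -> dom g y &
  forall u v y, g (u, y) -> g (v, y) -> u = v].
have [F FP Ftot|g [[gdom gran ginj] gmax]] := @Zorn_bigcup _ P.
  have FF p q : (\bigcup_(X in F) X) p -> (\bigcup_(X in F) X) q ->
      exists2 X, F X & X p /\ X q.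
    move=> [X FX Xp] [Y FY Yq].
    by have [s|s] := Ftot _ _ FX FY; [exists Y|exists X] => //; split=> //; exact: s.
  split.
  - move=> x b y [X FX Xp]; have [/(_ _ _ _ Xp)[Ax H] _ _] := FP _ FX.
    by split=> // b'; have [y' Xy'] := H b'; exists y', X.
  - move=> x b y [X FX Xp]; have [_ /(_ _ _ _ Xp)[b' [y' Xy']] _] := FP _ FX.
    by exists b', y', X.
  - move=> u v y Hu Hv; have [X FX [Xu Xv]] := FF _ _ Hu Hv.
    by have [_ _ H] := FP _ FX; exact: H Xu Xv.
have domA : dom g `<=` A by move=> x [b [y /gdom[]]].
have dom2 : dom g `*` [set: bool] #<= dom g.
  apply: (@rel_card_le _ _ _ _ (fun u y => g (u, y))).
    move=> [x b] [/= [b0 [y0 /gdom[_ /(_ b)[y gy]]]] _].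
    by exists y => //; exact: gran gy.
  by move=> u v y _ _; exact: ginj.
have fin : finite_set (A `\` dom g).
  apply: contrapT => /infiniteP/card_le_rel[r [rtot rinj rfun rAB]].
  pose h := [set p : (T * bool) * T | exists n : nat,
    r n p.1.1 /\ r (n.*2 + p.1.2)%N p.2].
  apply: (gmax (g `|` h)).
    split; first by move=> ? ?; left.
    have [x [Ax ndx] r0x] := rtot 0%N I.
    move=> /(_ ((x, false), x)) H; apply: ndx; exists false, x; apply: H.
    by right; exists 0%N.
  have domh n x : r n x -> dom h x.
    move=> rnx; have [y _ ry] := rtot (n.*2 + false)%N I.
    by exists false, y, n.
  split.
  - move=> x b y [/gdom[Ax H]|[n [/= rx ry]]].
      by split=> // b'; have [y' ?] := H b'; exists y'; left.
    split; first by have [_ []] := rAB _ _ rx.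
    move=> b'; have [y' _ ry'] := rtot (n.*2 + b')%N I.
    by exists y'; right; exists n.
  - move=> x b y [/gran[b' [y' gy]]|[n [/= rx /domh[b' [y' hy]]]]].
      by exists b', y'; left.
    by exists b', y'; right.
  - have gh u v y : g (u, y) -> h (v, y) -> False.
      case: u => x b /gran dy [n [_ /= ry]].
      by have [_ []] := rAB _ _ ry.
    move=> [x b] [x' b'] y [gu|hu] [gv|hv].
    + exact: ginj gu gv.
    + by case: (gh _ _ _ gu hv).
    + by case: (gh _ _ _ gv hu).
    + case: hu => n [/= rx ry]; case: hv => m [/= rx' ry'].
      have e : (n.*2 + b)%N = (m.*2 + b')%N by exact: rinj ry ry'.
      have bb : b = b'.
        by move/(congr1 odd): e; rewrite !oddD !odd_double !oddb.
      have nm : n = m.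
        by move/(congr1 half): e; rewrite bb ![(_.*2 + _)%N]addnC !half_bit_double.
      by move: rx'; rewrite -nm => rx'; rewrite bb (rfun _ _ _ rx rx').
have domI : infinite_set (dom g).
  move=> dfin; apply: Ainf; apply: (@sub_finite_set _ _ (dom g `|` (A `\` dom g))).
    by move=> x Ax; have [|] := pselect (dom g x); [left|right].
  by rewrite finite_setU.
have finle : A `\` dom g #<= dom g.
  by apply: card_le_trans ((infiniteP _).1 domI); exact: finite_set_countable.
have Ale : A #<= dom g.
  have [r [rtot rinj rfun rAB]] := card_le_rel finle.
  apply: card_le_trans dom2.
  pose s x (u : T * bool) := if u.2 then r x u.1 else dom g x /\ u.1 = x.
  apply: (@rel_card_le _ _ _ _ s).
    move=> x Ax; have [dx|ndx] := pselect (dom g x); first by exists (x, false).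
    have [|y dy rxy] := rtot x; first by split.
    by exists (y, true).
  move=> x x' [y []] _ _; rewrite /s /=; first exact: rinj.
  by move=> [_ ->] [_ ->].
apply: card_le_trans (subset_card_le domA); apply: card_le_trans dom2.
have [r [rtot rinj _ _]] := card_le_rel Ale.
apply: (@rel_card_le _ _ _ _ (fun u v => r u.1 v.1 /\ u.2 = v.2)).
  by move=> [x b] [/= /rtot[y dy rxy] _]; exists (y, b).
by move=> [x b] [x' b'] [y c] _ _ /= [/rinj H ->] [/H -> ->].
Qed.

Lemma card_ltU T U (A B : set T) (C : set U) : infinite_set C ->
  A #< C -> B #< C -> A `|` B #< C.
Proof.
move=> Cinf.
wlog AB : A B / A #<= B.
  move=> wl AC BC; have [AB|BA] := card_le_total A B; first exact: wl.
  by rewrite setUC; exact: wl.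
move=> [AC nCA] [BC nCB].
have [Binf|Bfin] := pselect (infinite_set B); last first.
  have ABfin : finite_set (A `|` B).
    rewrite finite_setU; split; last exact: contrapT.
    by apply: card_le_finite AB _; exact: contrapT.
  split; last by move=> CAB; apply: Cinf; exact: card_le_finite CAB ABfin.
  by apply: card_le_trans ((infiniteP _).1 Cinf); exact: finite_set_countable.
suff ABB : A `|` B #<= B.
  split; first exact: card_le_trans ABB BC.
  by move=> CAB; apply: nCB; exact: card_le_trans CAB ABB.
apply: card_le_trans (card_setX_bool Binf).
have [r [rtot rinj _ _]] := card_le_rel AB.
apply: (@rel_card_le _ _ _ _ (fun x u => if u.2 then r x u.1 else x = u.1)).
  move=> x [/rtot[y By rxy]|Bx]; first by exists (y, true).
  by exists (x, false).
by move=> x x' [y []] _ _ /=; [exact: rinj|move=> -> ->].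
Qed.

Section Separation.
Variable T : topologicalType.

Definition T1_regular := accessible_space T /\ regular_space T.

Definition T1_completely_regular (R : realType) :=
  accessible_space T /\
  forall (x : T) (B : set T), closed B -> ~ B x ->
    exists f : T -> R, [/\ continuous f, range f `<=` `[0, 1],
      f x = 0 & forall y, B y -> f y = 1].

(* Agreement with the library, whose completely_regular_space is phrased with
   uniformities and does not include T1. *)
Lemma T1_completely_regularE (R : realType) :
  T1_completely_regular R <-> accessible_space T /\ completely_regular_space T.
Proof.
split=> -[aT crT]; split=> // x B clB nBx.
  have [f [cf f01 fx fB]] := crT x B clB nBx.
  apply/(@uniform_separatorP _ R); exists f; split=> //.
    by move=> _ [y -> <-].
  by move=> _ [y By <-]; exact: fB.
have /(@uniform_separatorP _ R)[f [cf f01 fx fB]] := crT x B clB nBx.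
exists f; split=> //; first by apply: fx; exists x.
by move=> y By; apply: fB; exists y.
Qed.

End Separation.

(* A proper lambda^+-complete ideal on the set A that contains all singletons;
   lambda is the cardinality of L. *)
Record proper_complete_ideal (L T : Type) (A : set T) (J : set (set T)) : Prop := {
  ideal_sub : forall H, J H -> H `<=` A ;
  ideal_down : forall H H', J H -> H' `<=` H -> J H' ;
  ideal_bigcup : forall F : set (set T),
    F `<=` J -> F #<= [set: L] -> J (\bigcup_(H in F) H) ;
  ideal_proper : ~ J A ;
  ideal_set1 : forall x, A x -> J [set x]
}.

Section Base.
Variables (K L : Type) (A : int -> set K) (I : int -> set (set K)).

Definition diagonal : set (K * K) := [set a | a.1 = a.2].

Definition diagonal_at (k : int) : set (K * K) := diagonal `&` (A k `*` A k).

Definition Gamma (k : int) (x : K) (G F : set K) : set (K * K) :=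
  [set (x, x)] `|` ([set x] `*` (A (k - 1) `\` G))
  `|` ((A (k + 1) `\` F) `*` [set x]).

Definition plane_base : set (set (K * K)) :=
  [set U | exists2 a, ~ diagonal a & U = [set a]] `|`
  [set U | exists k x G F,
     [/\ A k x, G #< [set: L], I (k + 1) F & U = Gamma k x G F]].

End Base.

(* plane is the space X = kappa^2. Its proof arguments do not occur in the
   body: they are what makes plane_base the base of a topology (disjointness of
   the A k, closure of the ideals and of |G| < lambda under binary unions).
   The same holds for two_point_ext below. *)
Definition plane (K L : Type) (A : int -> set K) (I : int -> set (set K))
  (L_inf : infinite_set [set: L]) (A_part : partition [set: int] A [set: K])
  (I_ideal : forall k, proper_complete_ideal L (A k) (I k)) : Type := (K * K)%type.

Section Plane.
Context {K L : Type} {A : int -> set K} {I : int -> set (set K)}.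
Variables (L_inf : infinite_set [set: L])
  (A_part : partition [set: int] A [set: K])
  (I_ideal : forall k, proper_complete_ideal L (A k) (I k)).
Local Notation X := (plane L_inf A_part I_ideal).
Local Notation base := (plane_base L A I).

Lemma part_uniq i j x : A i x -> A j x -> i = j.
Proof. by case: A_part => _ tA _ Ai Aj; apply: tA => //; exists x. Qed.

Lemma part_ex x : exists k, A k x.
Proof.
case: A_part => cA _ _; have : cover [set: int] A x by rewrite cA.
by case=> k _ Akx; exists k.
Qed.

Lemma ideal_set0 k : I k set0.
Proof.
have := @ideal_bigcup _ _ _ _ (I_ideal k) set0; rewrite bigcup_set0.
by apply=> //; exact: card_ge0.
Qed.

Lemma ideal_setU k F1 F2 : I k F1 -> I k F2 -> I k (F1 `|` F2).
Proof.
move=> I1 I2.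
have := @ideal_bigcup _ _ _ _ (I_ideal k) [set F1; F2]; rewrite bigcup_setU.
rewrite !bigcup_set1; apply; first by move=> ? [->|->].
apply: card_le_trans ((infiniteP _).1 L_inf); apply: finite_set_countable.
exact: finite_set2.
Qed.

Lemma set0_lt : @set0 K #< [set: L].
Proof.
split; first exact: card_ge0.
by move=> H; apply: L_inf; exact: card_le_finite H (finite_set0 _).
Qed.

Lemma Gamma_diag k x y G F : Gamma A k x G F (y, y) -> x = y.
Proof. by move=> [[[<-]|[]]|[]]. Qed.

Let base_cover : \bigcup_(U in base) U = [set: X].
Proof.
rewrite -subTset => -[x y] _; have [exy|nxy] := pselect (x = y).
  have [k Akx] := part_ex x.
  exists (Gamma A k x set0 set0); last by left; left; rewrite exy.
  by right; exists k, x, set0, set0; split=> //; [exact: set0_lt|exact: ideal_set0].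
by exists [set (x, y)] => //; left; exists (x, y).
Qed.

Let base_join (U V : set X) (t : X) : base U -> base V -> U t -> V t ->
  exists W : set X, [/\ base W, W t & W `<=` U `&` V].
Proof.
case: t => x y bU bV Ut Vt; have [exy|nxy] := pselect (x = y); last first.
  exists [set (x, y)]; split => //; first by left; exists (x, y).
  by move=> _ ->.
move: Ut Vt; rewrite -{y}exy => Ut Vt.
have H (W : set (K * K)) : base W -> W (x, x) -> exists k G F,
    [/\ A k x, G #< [set: L], I (k + 1) F & W = Gamma A k x G F].
  move=> [[a na ->] e|[k [z [G [F [Az GL IF ->]]]]] /Gamma_diag e].
    by exfalso; apply: na; rewrite -e.
  by rewrite -e; exists k, G, F.
have [k [G [F [Ax GL IF eU]]]] := H _ bU Ut.
have [k' [G' [F' [Ax' GL' + eV]]]] := H _ bV Vt.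
have ek := part_uniq Ax Ax'; rewrite -{}ek in Ax' eV * => IF'.
exists (Gamma A k x (G `|` G') (F `|` F')); split.
- right; exists k, x, (G `|` G'), (F `|` F'); split=> //.
    exact: card_ltU.
  exact: ideal_setU.
- by left; left.
- rewrite eU eV => p [[->|[p1 [p2 /not_orP[nG nG']]]]|[[p1 /not_orP[nF nF']] p2]].
  + by split; left; left.
  + by split; left; right.
  + by split; right.
Qed.

HB.instance Definition _ := gen_eqMixin X.
HB.instance Definition _ := gen_choiceMixin X.
HB.instance Definition _ := isBaseTopological.Build X base_cover base_join.

Lemma plane_baseP (U : set X) :
  (forall t, U t -> exists2 W : set X, base W & W t /\ W `<=` U) -> open U.
Proof.
move=> H; exists [set W | base W /\ W `<=` U]; first by move=> W [].
apply/seteqP; split=> [t [W [_ WU] Wt]|t /H[W bW [Wt WU]]]; first exact: WU.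
by exists W.
Qed.

Lemma plane_open_locally (U : set X) :
  (forall k x, A k x -> U (x, x) -> Gamma A k x set0 set0 `<=` U) -> open U.
Proof.
move=> H; apply: plane_baseP => -[x y] Uxy; have [exy|nxy] := pselect (x = y).
  have [k Akx] := part_ex x; rewrite -exy in Uxy *.
  exists (Gamma A k x set0 set0); last by split; [left; left|exact: H].
  by right; exists k, x, set0, set0; split=> //; [exact: set0_lt|exact: ideal_set0].
by exists [set (x, y)]; [left; exists (x, y)|split=> // _ ->].
Qed.

End Plane.

Inductive add_ends (T : Type) := Fin of T | PInf | NInf.
Arguments PInf {T}.
Arguments NInf {T}.

Definition two_point_ext (K L : Type) (A : int -> set K)
  (I : int -> set (set K)) (L_inf : infinite_set [set: L])
  (A_part : partition [set: int] A [set: K])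
  (I_ideal : forall k, proper_complete_ideal L (A k) (I k)) : Type :=
  add_ends (plane L_inf A_part I_ideal).

Section TwoPointExt.
Context {K L : Type} {A : int -> set K} {I : int -> set (set K)}.
Variables (L_inf : infinite_set [set: L])
  (A_part : partition [set: int] A [set: K])
  (I_ideal : forall k, proper_complete_ideal L (A k) (I k)).
Local Notation X := (plane L_inf A_part I_ideal).
Local Notation Xs := (two_point_ext L_inf A_part I_ideal).

(* nbhs_pinf m and nbhs_ninf m are V^+_m and V^-_m. *)
Definition tail_pinf (m : int) : set X :=
  \bigcup_(n in [set n | m < n]) (A n `*` [set: K]).

Definition tail_ninf (m : int) : set X :=
  (\bigcup_(n in [set n | n <= m]) (A n `*` [set: K])) `\` diagonal_at A m.

Definition nbhs_pinf (m : int) : set Xs := [set PInf] `|` @Fin X @` tail_pinf m.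

Definition nbhs_ninf (m : int) : set Xs := [set NInf] `|` @Fin X @` tail_ninf m.

Definition ext_base : set (set Xs) :=
  [set V | exists2 U : set X, open U & V = @Fin X @` U] `|`
  range nbhs_pinf `|` range nbhs_ninf.

Lemma open_tail_pinf m : open (tail_pinf m).
Proof.
apply: plane_open_locally => k x Akx [n /= mn [/= Anx _]].
have nk := part_uniq A_part Akx Anx; rewrite -{n Anx}nk in mn.
move=> p [[->|[p1 _]]|[[p1 _] _]].
- by exists k.
- by exists k => //; split=> //; rewrite p1.
- by exists (k + 1) => //=; lia.
Qed.

Lemma open_tail_ninf m : open (tail_ninf m).
Proof.
apply: plane_open_locally => k x Akx [[n /= nm [/= Anx _]] nD].
have nk := part_uniq A_part Akx Anx; rewrite -{n Anx}nk in nm.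
have km : k != m.
  by apply/eqP => km; apply: nD; split=> //; rewrite -km.
have notD n p : n <= m -> A n p.1 -> n != m -> ~ diagonal_at A m p.
  move=> _ Anp + [_ [Amp _]].
  by rewrite (part_uniq A_part Anp Amp) eqxx.
move=> p [[->|[p1 p2]]|[[p1 _] p2]].
- by split=> //; exists k.
- have Ap : A k p.1 by rewrite p1.
  by split; [exists k|exact: (notD k)].
- split; first by exists (k + 1) => //=; lia.
  move=> [dp [_ Amp]]; rewrite p2 in Amp.
  by move: km; rewrite (part_uniq A_part Akx Amp) eqxx.
Qed.

Lemma tail_pinf_le m m' : m <= m' -> tail_pinf m' `<=` tail_pinf m.
Proof. by move=> mm p [n /= mn Ap]; exists n => //=; lia. Qed.

Lemma tail_ninf_le m m' : m <= m' -> tail_ninf m `<=` tail_ninf m'.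
Proof.
move=> mm p [[n /= nm [/= Ap _]] nD]; split; first by exists n => //=; lia.
move=> [dp [Amp Amp2]]; apply: nD.
have e := part_uniq A_part Ap Amp; have -> : m = m' by lia.
by [].
Qed.

Let ext_cover : \bigcup_(U in ext_base) U = [set: Xs].
Proof.
rewrite -subTset => -[p||] _.
- by exists (@Fin X @` setT); [left; left; exists setT => //; exact: openT|exists p].
- by exists (nbhs_pinf 0); [left; right; exists 0|left].
- by exists (nbhs_ninf 0); [right; exists 0|left].
Qed.

Let trace (V : set Xs) : ext_base V -> open (@Fin X @^-1` V).
Proof.
move=> [[[U oU ->]|[m _ <-]]|[m _ <-]].
- suff -> : @Fin X @^-1` (@Fin X @` U) = U by [].
  by apply/seteqP; split=> [p [q Uq [<-]]|p Up] //; exists p.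
- suff -> : @Fin X @^-1` nbhs_pinf m = tail_pinf m by exact: open_tail_pinf.
  by apply/seteqP; split=> [p [//|[q Uq [<-]]]|p Up] //; right; exists p.
- suff -> : @Fin X @^-1` nbhs_ninf m = tail_ninf m by exact: open_tail_ninf.
  by apply/seteqP; split=> [p [//|[q Uq [<-]]]|p Up] //; right; exists p.
Qed.

Let at_pinf V : ext_base V -> V PInf -> exists m, V = nbhs_pinf m.
Proof.
by move=> [[[U oU ->] [? ? //]|[m _ <-] _]|[m _ <-] [//|[? ? //]]]; exists m.
Qed.

Let at_ninf V : ext_base V -> V NInf -> exists m, V = nbhs_ninf m.
Proof.
by move=> [[[U oU ->] [? ? //]|[m _ <-] [//|[? ? //]]]|[m _ <-] _]; exists m.
Qed.

Let ext_join (U V : set Xs) (t : Xs) : ext_base U -> ext_base V -> U t -> V t ->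
  exists W : set Xs, [/\ ext_base W, W t & W `<=` U `&` V].
Proof.
case: t => [p||] bU bV Ut Vt.
- exists (@Fin X @` (@Fin X @^-1` (U `&` V))); split.
  + left; left; eexists; last by [].
    by rewrite preimage_setI; apply: openI; exact: trace.
  + by exists p.
  + by move=> _ [q ? <-].
- have [m ->] := at_pinf bU Ut; have [m' ->] := at_pinf bV Vt.
  exists (nbhs_pinf (Num.max m m')); split; [by left; right; eexists|by left|].
  move=> _ [->|[p tp <-]]; first by split; left.
  by split; right; exists p => //; move: tp; apply: tail_pinf_le; lia.
- have [m ->] := at_ninf bU Ut; have [m' ->] := at_ninf bV Vt.
  exists (nbhs_ninf (Num.min m m')); split; [by right; eexists|by left|].
  move=> _ [->|[p tp <-]]; first by split; left.
  by split; right; exists p => //; move: tp; apply: tail_ninf_le; lia.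
Qed.

HB.instance Definition _ := gen_eqMixin Xs.
HB.instance Definition _ := gen_choiceMixin Xs.
HB.instance Definition _ := isBaseTopological.Build Xs ext_cover ext_join.

End TwoPointExt.

(* Main.v *)
Require Import Defs.
From mathcomp Require Import all_boot all_order all_algebra.
From mathcomp Require Import all_classical all_reals all_analysis.
From mathcomp Require Import zify.
Import numFieldNormedType.Exports.
Import Order.TTheory GRing.Theory Num.Theory.
Local Open Scope classical_set_scope.
Local Open Scope card_scope.
Local Open Scope ring_scope.

(** The heart of the matter is that every continuous [f : X* -> R] takes one
    and the same value [c] at almost all diagonal points: for every level [k]
    the [x] in [A k] with [f (x, x) <> c] form a set of [I k]. As [I k] is
    proper, such points [(x, x)] exist at all levels, hence in all neighbourhoods
    of both ends, and [f] equals [c] at both ends.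

    The constant arises by playing the two halves of a basic neighbourhood
    against each other. Continuity at [(y, y)], with [y] in [A k], controls [f]
    on the horizontal segment [A (k + 1) * {y}] up to a set of the ideal, and the
    ideal is closed under countable unions, so that [f (x, y) = f (y, y)] for
    almost all [x] in [A (k + 1)] ([column_ae_const]). Now take an injective family
    [(g l)], indexed by [L], of points of [A k]. As the ideal is closed under
    unions of [|L|] sets, almost every [x] in [A (k + 1)] satisfies
    [f (x, g l) = f (g l, g l)] for all [l] at once; but continuity at [(x, x)]
    along the vertical segment [{x} * A k] makes [f (x, g l)] close to [f (x, x)]
    for all but fewer than [|L|] indices. So [f (g l, g l)] converges to [f (x, x)]
    for almost every [x] ([diag_cvg_along]). Such a limit is unique, hence the
    diagonal values are almost constant on each level ([diag_ae_const]); choosing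
    the family among the points where the constant of level [k] is attained shows
    that level [k + 1] has the same constant ([diag_ae_const_uniform]).

    Regularity is elementary: the basic open sets of the plane are clopen in
    [X*], and the complement of a basic neighbourhood of one end is contained in
    a basic neighbourhood of the other. Since no continuous function separates the
    two ends, [X*] is not completely regular; nor is it so after removal of one
    end, since a function on the rest that is constant near the missing end
    extends continuously to [X*] ([indist_sub_not_completely_regular]). *)

(** * Separation properties and continuous functions on subspaces *)

Lemma open_subtypeP (T : topologicalType) (Y : set T) (U : set (set_type Y)) :
  open U <-> exists2 W : set T, open W & U = set_val @^-1` W.
Proof. by split=> [[W oW <-]|[W oW ->]]; exists W. Qed.

Lemma T1_regular_subtype (T : topologicalType) (Y : set T) :
  T1_regular T -> T1_regular (set_type Y).
Proof.
move=> [aT rT]; split=> [x y xy|x].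
  have [|U [oU xU yU]] := aT (set_val x) (set_val y).
    by apply: contra_neq xy; exact: val_inj.
  exists (set_val @^-1` U); split; first by apply/open_subtypeP; exists U.
    by move: xU; rewrite !inE.
  by move: yU; rewrite !inE.
apply/regular_openP => B clB nBx.
have /open_subtypeP[W oW BW] := closed_openC clB.
have [|U [V [oU oV Ux WV UV]]] :=
    (regular_openP (set_val x)).1 (rT _) _ (open_closedC oW).
  by apply; rewrite -[W _]/((set_val @^-1` W) x) -BW.
exists (set_val @^-1` U), (set_val @^-1` V); split=> //.
- by apply/open_subtypeP; exists U.
- by apply/open_subtypeP; exists V.
- move=> y By; apply: WV => Wy.
  by have : (~` B) y by rewrite BW.
- by rewrite -preimage_setI UV preimage_set0.
Qed.

Lemma continuous_openP (R : realType) (T : topologicalType) (f : T -> R) :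
  continuous f <-> forall x e, 0 < e ->
    exists2 U : set T, open_nbhs x U & forall y, U y -> `|f x - f y| < e.
Proof.
split=> [cf x e e0|H x].
  have : nbhs x [set y | `|f x - f y| < e].
    by have /cvgrPdist_lt/(_ e e0) := cf x.
  by rewrite nbhsE => -[U Ux Uf]; exists U.
apply/cvgrPdist_lt => e e0; have [U Ux Uf] := H x e e0.
by apply: filterS Uf _; exact: open_nbhs_nbhs.
Qed.

(** Away from [p] the subspace is open, so continuity is inherited from [f];
    at [p] it holds because [g] is locally constant there. *)
Lemma continuous_extend_point (R : realType) (T : topologicalType) (p : T)
    (U : set T) (f : set_type (~` [set p]) -> R) (g : T -> R) :
  closed [set p] -> continuous f -> (forall y, g (set_val y) = f y) ->
  open_nbhs p U -> (forall x, U x -> g x = g p) -> continuous g.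
Proof.
move=> clp /continuous_openP cf gf pU gU; apply/continuous_openP => x e e0.
have [->|xp] := pselect (x = p).
  by exists U => // y Uy; rewrite gU ?subrr ?normr0.
have xY : x \in ~` [set p] by exact: mem_set.
have [V [/open_subtypeP[W oW ->] Wx] Vf] := cf (SigSub xY) e e0.
exists (W `&` ~` [set p]).
  by split=> //; apply: openI => //; exact: closed_openC.
move=> y [Wy yp]; have yY : y \in ~` [set p] by exact: mem_set.
by have := Vf (SigSub yY) Wy; rewrite -!gf.
Qed.

(** Two points at which all continuous real functions agree. *)
Section Indistinguishable.
Variables (R : realType) (T : topologicalType) (p q : T).
Hypotheses (regT : T1_regular T) (pq : p <> q)
  (fpq : forall f : T -> R, continuous f -> f p = f q).

Lemma indist_not_completely_regular : ~ T1_completely_regular T R.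
Proof.
move=> [aT /(_ q [set p])[]]; first exact: accessible_closed_set1.
  by move=> /esym.
move=> f [cf _ fq fp]; have := fpq _ cf; rewrite fp// fq => /eqP.
by rewrite oner_eq0.
Qed.

(** Regularity of [T] gives disjoint open [U] and [V] around [q] and [p]. A
    function [f] on the subspace with [f q = 0] and [f = 1] off [U] is constant on
    [V], so it extends to [T] by the value [1] at [p], and the extension separates
    [p] from [q]. *)
Lemma indist_sub_not_completely_regular :
  ~ T1_completely_regular (set_type (~` [set p])) R.
Proof.
have [aT rT] := regT; have clp : closed [set p] by exact: accessible_closed_set1.
move=> [_ crY].
have [|U [V [oU oV Uq pV UV]]] := (regular_openP q).1 (rT _) _ clp.
  by move=> /esym.
have qY : q \in ~` [set p] by apply: mem_set => /esym.
have [||f [cf _ fq fB]] := crY (SigSub qY) (set_val @^-1` (~` U)).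
- by rewrite -openC -preimage_setC setCK; apply/open_subtypeP; exists U.
- by apply; exact: Uq.
pose g x := if pselect ((~` [set p]) x) is left yx then f (SigSub (mem_set yx))
  else 1.
have gf y : g (set_val y) = f y.
  rewrite /g; case: pselect => [yx|[]]; last exact: set_valP.
  by congr f; exact: val_inj.
have gV x : V x -> g x = 1.
  move=> Vx; rewrite /g; case: pselect => // yx; apply: fB => /= Ux.
  by have : (U `&` V) x by []; rewrite UV.
have cg : continuous g.
  apply: (continuous_extend_point _ _ _ V f g clp cf gf).
    by split=> //; exact: pV.
  by move=> x Vx; rewrite !gV//; exact: pV.
have := fpq _ cg; rewrite gV; last exact: pV.
by rewrite (gf (SigSub qY)) fq => /eqP; rewrite oner_eq0.
Qed.

End Indistinguishable.

(** * Open sets of the plane and of its two-point extension *)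

Section Space.
Context {K L : Type} {A : int -> set K} {I : int -> set (set K)}.
Variables (L_inf : infinite_set [set: L])
  (A_part : partition [set: int] A [set: K])
  (I_ideal : forall k, proper_complete_ideal L (A k) (I k)).
Local Notation X := (plane L_inf A_part I_ideal).
Local Notation Xs := (two_point_ext L_inf A_part I_ideal).

Local Notation Vpos m := (@nbhs_pinf K L A I L_inf A_part I_ideal m).
Local Notation Vneg m := (@nbhs_ninf K L A I L_inf A_part I_ideal m).
Local Notation base_ext := (@ext_base K L A I L_inf A_part I_ideal).

Lemma set1_lt (x : K) : [set x] #< [set: L].
Proof.
split; last by move=> /card_le_finite H; apply: L_inf; exact: H (finite_set1 _).
by apply: card_le_trans ((infiniteP _).1 L_inf); apply: finite_set_countable.
Qed.

Lemma ideal_trace1 k x : I k ([set x] `&` A k).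
Proof.
have [Akx|nAkx] := pselect (A k x).
  by apply: (ideal_down (I_ideal k) (ideal_set1 (I_ideal k) Akx)) => y [].
rewrite (_ : _ `&` _ = set0); first exact: ideal_set0.
by rewrite -subset0 => y [-> /nAkx].
Qed.

Lemma plane_openP (U : set X) (t : X) : open U -> U t ->
  exists2 W : set X, plane_base L A I W & W t /\ W `<=` U.
Proof.
move=> oU; have [D Db UE] : exists2 D : set (set X),
  D `<=` plane_base L A I & \bigcup_(W in D) W = U := oU.
rewrite -UE => -[W DW Wt]; exists W; first exact: Db.
by split=> // y Wy; exists W.
Qed.

Lemma plane_base_open (W : set X) : plane_base L A I W -> open W.
Proof. by move=> bW; apply: plane_baseP => t Wt; exists W => //; split. Qed.

Lemma open_diag_Gamma (U : set X) k x : A k x -> open U -> U (x, x) ->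
  exists G F, [/\ G #< [set: L], I (k + 1) F & Gamma A k x G F `<=` U].
Proof.
move=> Akx oU Ux; have [W bW [Wx WU]] := plane_openP _ _ oU Ux.
case: bW Wx WU => [[a na ->] ea|[j [y [G [F [Ajy GL IF ->]]]]] Wx].
  by exfalso; apply: na; rewrite -ea.
have yx : y = x by move: Wx; exact: Gamma_diag.
rewrite {}yx in Ajy *; have kj := part_uniq A_part Akx Ajy; subst j => WU.
by exists G, F.
Qed.

(** A basic neighbourhood of [(y, y)] tailored to avoid [p]. The second
    exceptional set is cut down to level [j + 1] because the ideal contains only
    subsets of that level. *)
Definition Gamma_avoid j y (p : K * K) : set (K * K) :=
  Gamma A j y [set p.2] ([set p.1] `&` A (j + 1)).

Lemma plane_base_Gamma_avoid j y p : A j y -> plane_base L A I (Gamma_avoid j y p).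
Proof.
move=> Ajy; right; exists j, y, [set p.2], ([set p.1] `&` A (j + 1)); split=> //.
  exact: set1_lt.
exact: ideal_trace1.
Qed.

Lemma Gamma_avoidP j y (p : K * K) : p <> (y, y) -> ~ Gamma_avoid j y p p.
Proof. by move=> py [[//|[_ [_ []]]]|[[Ap nA] _]] //; apply: nA. Qed.

(** Off their centres, two basic neighbourhoods of [(x, x)] and [(y, y)] can only
    meet at [(x, y)] or [(y, x)], and avoiding [(x, x)] removes exactly these. *)
Lemma Gamma_avoid_disjoint k x G F j y : x <> y ->
  Gamma A k x G F `&` Gamma_avoid j y (x, x) = set0.
Proof.
move=> xy; rewrite -subset0 => -[a b] /=.
move=> [[[[-> ->]|[/= -> _]]|[/= _ ->]] [[[e1 e2]|[/= e1 [_ e2]]]|[/= [Ap e1] e2]]].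
all: try by apply: xy.
all: try by apply: e1.
all: try by apply: e2.
Qed.

Lemma plane_base_closed (W : set X) : plane_base L A I W -> closed W.
Proof.
move=> bW; rewrite -openC; apply: plane_baseP => -[y z] nWyz.
have [yz|nyz] := pselect (y = z); last first.
  exists [set (y, z)]; first by left; exists (y, z).
  by split=> // _ ->.
rewrite -{z}yz in nWyz *; have [j Ajy] := part_ex A_part y.
suff [p pW] : exists p, Gamma_avoid j y p `&` W = set0.
  exists (Gamma_avoid j y p); first exact: plane_base_Gamma_avoid.
  by split; [left; left|exact/disjoints_subset].
case: bW nWyz => [[a na ->] ay|[k [x [G [F [Akx _ _ ->]]]]] nWy].
  exists a; apply/disjoints_subset => t + ta; rewrite {}ta.
  by apply: Gamma_avoidP => // e; apply: ay; rewrite -e.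
exists (x, x); rewrite setIC; apply: Gamma_avoid_disjoint => xy.
by apply: nWy; left; left; rewrite xy.
Qed.

(** This is what keeps basic sets of the plane away from both ends. *)
Lemma plane_base_bounded (W : set (K * K)) : plane_base L A I W ->
  exists k, W `<=` (A k `|` A (k + 1)) `*` [set: K].
Proof.
move=> [[a na ->]|[k [x [G [F [Akx _ _ ->]]]]]].
  have [k Aka] := part_ex A_part a.1.
  by exists k => _ ->; split=> //; left.
exists k => p [[->|[p1 _]]|[[Ap _] _]]; split=> //; first by left.
- by left; rewrite p1.
- by right.
Qed.

Lemma ext_openP (V : set Xs) : open V <->
  [/\ open (@Fin X @^-1` V),
      V PInf -> exists m, Vpos m `<=` V &
      V NInf -> exists m, Vneg m `<=` V].
Proof.
have FinK (U : set X) : @Fin X @^-1` (@Fin X @` U) = U.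
  by apply/seteqP; split=> [p [q Uq [<-]]|p Up] //; exists p.
split.
  move=> oV; have [D Db VE] : exists2 D : set (set Xs),
    D `<=` base_ext & \bigcup_(W in D) W = V := oV.
  rewrite -{}VE {oV}; split.
  - rewrite preimage_bigcup; apply: bigcup_open => W /Db.
    move=> [[[U oU ->]|[m _ <-]]|[m _ <-]]; first by rewrite FinK.
      rewrite preimage_setU FinK; apply: openU; last exact: open_tail_pinf.
      by rewrite (_ : _ @^-1` _ = set0) -?subset0//; exact: open0.
    rewrite preimage_setU FinK; apply: openU; last exact: open_tail_ninf.
    by rewrite (_ : _ @^-1` _ = set0) -?subset0//; exact: open0.
  - move=> [W DW WP]; case: (Db _ DW) => [[[U _ e]|[m _ e]]|[m _ e]].
    + by move: WP; rewrite e => -[].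
    + by exists m => p Wp; exists W => //; rewrite -e.
    + by move: WP; rewrite -e => -[|[]].
  - move=> [W DW WP]; case: (Db _ DW) => [[[U _ e]|[m _ e]]|[m _ e]].
    + by move: WP; rewrite e => -[].
    + by move: WP; rewrite -e => -[|[]].
    + by exists m => p Wp; exists W => //; rewrite -e.
move=> [oV VP VN].
exists [set W | base_ext W /\ W `<=` V].
  by move=> W [].
apply/seteqP; split=> [t [W [_ WV] Wt]|[p||] Vt]; first exact: WV.
- exists (@Fin X @` (@Fin X @^-1` V)); last by exists p.
  split; last by move=> _ [q Vq <-].
  by left; left; exists (@Fin X @^-1` V).
- have [m mV] := VP Vt; exists (Vpos m); last by left.
  by split=> //; left; right; exists m.
- have [m mV] := VN Vt; exists (Vneg m); last by left.
  by split=> //; right; exists m.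
Qed.

Lemma open_nbhs_pinf m : open (Vpos m).
Proof.
by exists [set Vpos m]; rewrite ?bigcup_set1// => _ ->; left; right; exists m.
Qed.

Lemma open_nbhs_ninf m : open (Vneg m).
Proof.
by exists [set Vneg m]; rewrite ?bigcup_set1// => _ ->; right; exists m.
Qed.

Lemma open_Fin (U : set X) : open U -> open (@Fin X @` U : set Xs).
Proof.
move=> oU; exists [set @Fin X @` U]; last by rewrite bigcup_set1.
by move=> _ ->; left; left; exists U.
Qed.

Lemma closed_Fin_base (W : set X) :
  plane_base L A I W -> closed (@Fin X @` W : set Xs).
Proof.
move=> bW; rewrite -openC; have [k Wk] := plane_base_bounded _ bW.
apply/ext_openP; split.
- rewrite -preimage_setC openC (_ : _ @^-1` _ = W).
    exact: plane_base_closed.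
  by apply/seteqP; split=> [p [q Wq [<-]]|p Wp] //; exists p.
- move=> _; exists (k + 1) => t + [p Wp ept]; rewrite -{}ept => -[//|[q + [qp]]].
  rewrite {}qp => -[n /= kn [Anp _]]; have [[Akp|Akp] _] := Wk _ Wp.
    by have := part_uniq A_part Anp Akp; lia.
  by have := part_uniq A_part Anp Akp; lia.
- move=> _; exists (k - 1) => t + [p Wp ept]; rewrite -{}ept => -[//|[q + [qp]]].
  rewrite {}qp => -[[n /= kn [Anp _]] _]; have [[Akp|Akp] _] := Wk _ Wp.
    by have := part_uniq A_part Anp Akp; lia.
  by have := part_uniq A_part Anp Akp; lia.
Qed.

Lemma nbhs_ends_disjoint m : Vpos m `&` Vneg m = set0.
Proof.
rewrite -subset0 => -[p||] []; last 2 first.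
- by move=> _ [//|[? _ //]].
- by move=> [//|[? _ //]].
move=> [//|[q [n mn [Aq _]] [qp]]] [//|[r [[j jm [Ar _]] _] [rp]]].
rewrite qp in Aq; rewrite rp in Ar.
by move: mn jm => /=; have := part_uniq A_part Aq Ar; lia.
Qed.

(** A point outside lies at a level at most [m], whereas the diagonal points left
    out of the right-hand side lie at level [m + 1]. Together with [nbhs_ends_disjoint] at
    [m + 1] this gives regularity at [+oo]. *)
Lemma nbhs_pinfC m : ~` Vpos m `<=` Vneg (m + 1).
Proof.
move=> [p||] np; [|by exfalso; apply: np; left|by left].
right; exists p => //; have [n Anp] := part_ex A_part p.1.
have nm : n <= m.
  by rewrite leNgt; apply/negP => mn; apply: np; right; exists p => //; exists n.
split; first by exists n => //=; lia.
by move=> [_ [/= Amp _]]; have := part_uniq A_part Anp Amp; lia.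
Qed.

Lemma nbhs_ninfC m : ~` Vneg m `<=` Vpos (m - 1).
Proof.
move=> [p||] np; [|by left|by exfalso; apply: np; left].
right; exists p => //; have [n Anp] := part_ex A_part p.1.
exists n => //=; have [mn|nm] := ltP m n; first lia.
have [->|nm'] := eqVneq n m; first lia.
exfalso; apply: np; right; exists p => //; split; first by exists n.
by move=> [_ [/= Amp _]]; have := part_uniq A_part Anp Amp; lia.
Qed.

(** * The extension is regular *)

Lemma accessible_ext : accessible_space Xs.
Proof.
move=> x y /eqP xy; suff [U [oU Ux nUy]] : exists U, [/\ open U, U x & ~ U y].
  by exists U; split; rewrite ?inE.
case: x xy => [x||] xy; last 2 first.
- case: y xy => [p _|//|_]; last first.
    exists (Vpos 0); split; [exact: open_nbhs_pinf|by left|].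
    by case=> // -[].
  have [k Akp] := part_ex A_part p.1.
  exists (Vpos k).
  split; [exact: open_nbhs_pinf|by left|case=> // -[q [n /= kn [Aq _]] [qp]]].
  by rewrite qp in Aq; have := part_uniq A_part Aq Akp; lia.
- case: y xy => [p _|_|//]; last first.
    exists (Vneg 0); split; [exact: open_nbhs_ninf|by left|].
    by case=> // -[].
  have [k Akp] := part_ex A_part p.1.
  exists (Vneg (k - 1)).
  split; [exact: open_nbhs_ninf|by left|case=> // -[q [[n /= kn [Aq _]] _] [qp]]].
  by rewrite qp in Aq; have := part_uniq A_part Aq Akp; lia.
suff [U oU [Ux Uy]] : exists2 U : set X, open U & U x /\ ~ (@Fin X @` U) y.
  by exists (@Fin X @` U); split=> //; exact: open_Fin.
case: x xy => a b; have [<-|nab] := pselect (a = b); last first.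
  exists [set (a, b)]; first by apply: plane_base_open; left; exists (a, b).
  by split=> // -[_ -> e]; apply: xy.
have [k Aka] := part_ex A_part a.
case: y => [p ap||_]; last 2 first.
- by exists setT; [exact: openT|split=> // -[]].
- by exists setT; [exact: openT|split=> // -[]].
exists (Gamma_avoid k a p).
  by apply: plane_base_open; exact: plane_base_Gamma_avoid.
split; first by left; left.
move=> [_ /[swap] [[->]]]; apply: Gamma_avoidP => e.
by apply: ap; rewrite e.
Qed.

Lemma regular_ext : regular_space Xs.
Proof.
move=> t; apply/regular_openP => B /closed_openC oB nBt.
have /ext_openP[oBX BP BN] := oB.
case: t nBt => [p||] nBt.
- have [W bW [Wp WB]] := plane_openP _ _ oBX nBt.
  exists (@Fin X @` W), (~` (@Fin X @` W)); split.
  + by apply: open_Fin; exact: plane_base_open.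
  + by apply: closed_openC; exact: closed_Fin_base.
  + by exists p.
  + by move=> _ /[swap] -[q Wq <-]; exact: WB.
  + exact: setICr.
- have [m mB] := BP nBt.
  exists (Vpos (m + 1)), (Vneg (m + 1)); split.
  + exact: open_nbhs_pinf.
  + exact: open_nbhs_ninf.
  + by left.
  + by move=> x Bx; apply: nbhs_pinfC => /mB.
  + exact: nbhs_ends_disjoint.
- have [m mB] := BN nBt.
  exists (Vneg (m - 1)), (Vpos (m - 1)); split.
  + exact: open_nbhs_ninf.
  + exact: open_nbhs_pinf.
  + by left.
  + by move=> x Bx; apply: nbhs_ninfC => /mB.
  + by rewrite setIC; exact: nbhs_ends_disjoint.
Qed.

(** * Continuous functions take the same value at both ends *)

Section ContinuousFunction.
Variables (R : realType) (f : Xs -> R) (cf : continuous f).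

Lemma continuous_Gamma k x e : A k x -> 0 < e ->
  exists G F, [/\ G #< [set: L], I (k + 1) F &
    forall p, Gamma A k x G F p -> `|f (Fin (x, x)) - f (Fin p)| < e].
Proof.
move=> Akx e0.
have [U [oU Ux] Uf] := (continuous_openP _ _ f).1 cf (Fin (x, x)) e e0.
have [oUX _ _] := (ext_openP _).1 oU.
have [G [F [GL IF GU]]] := open_diag_Gamma _ _ _ Akx oUX Ux.
by exists G, F; split=> // p /GU; exact: Uf.
Qed.

Lemma ideal_bigcupT T k (F : T -> set K) : [set: T] #<= [set: L] ->
  (forall t, I k (F t)) -> I k (\bigcup_t F t).
Proof.
move=> TL IF; have := @ideal_bigcup _ _ _ _ (I_ideal k) (range F).
rewrite bigcup_image; apply; first by move=> _ [t _ <-].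
exact: card_le_trans (card_image_le _ _) TL.
Qed.

(** For each [n] the points where the two values differ by [1 / (n + 1)] or more
    lie in the ideal, and countable unions stay in the ideal as [L] is infinite. *)
Lemma column_ae_const k y : A k y ->
  exists2 F, I (k + 1) F &
    forall x, A (k + 1) x -> ~ F x -> f (Fin (x, y)) = f (Fin (y, y)).
Proof.
move=> Aky.
have /choice[F FP] (n : nat) : exists F, I (k + 1) F /\
    forall x, A (k + 1) x -> ~ F x ->
      `|f (Fin (y, y)) - f (Fin (x, y))| < n.+1%:R^-1.
  have [|G [F [_ IF GF]]] := @continuous_Gamma k y n.+1%:R^-1 Aky.
    by rewrite invr_gt0 ltr0n.
  by exists F; split=> // x Ax nFx; apply: GF; right.
exists (\bigcup_n F n).
  by apply: ideal_bigcupT => [|n]; [exact/infiniteP|have [] := FP n].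
move=> x Ax nFx; apply/eqP; rewrite eq_sym -subr_eq0 -normr_le0 leNgt.
apply/negP => /ltr_add_invr[n]; rewrite add0r => /ltW; rewrite leNgt => /negP.
by apply; apply: (FP n).2 => // Fnx; apply: nFx; exists n.
Qed.

(** If [x] is outside the exceptional sets of all [g l], then
    [f (g l, g l) = f (x, g l)], and only the [g l] in the exceptional set [G]
    of a neighbourhood of [(x, x)] can make this differ much from [f (x, x)]. *)
Lemma diag_cvg_along k (g : L -> K) : injective g -> (forall l, A k (g l)) ->
  exists2 F, I (k + 1) F &
    forall x e, A (k + 1) x -> ~ F x -> 0 < e ->
      [set l | e <= `|f (Fin (x, x)) - f (Fin (g l, g l))|] #< [set: L].
Proof.
move=> ginj Ag.
have /choice[F FP] l : exists F, I (k + 1) F /\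
    forall x, A (k + 1) x -> ~ F x -> f (Fin (x, g l)) = f (Fin (g l, g l)).
  by have [F IF FE] := column_ae_const k (g l) (Ag l); exists F.
exists (\bigcup_l F l).
  by apply: ideal_bigcupT => [|l]; [exact: card_lexx|have [] := FP l].
move=> x e Ax nFx e0; have [G [F' [[GL nLG] _ GF]]] := continuous_Gamma _ _ _ Ax e0.
set S := [set l | _]; have SG : S #<= G.
  apply: (@rel_card_le _ _ _ _ (fun l y => g l = y));
    last by move=> l l' y _ _ <- /ginj.
  move=> l /= Sl.
  exists (g l) => //; apply: contrapT => nGl.
  have : Gamma A (k + 1) x G F' (x, g l).
    by left; right; split=> //; rewrite /= addrK.
  move=> /GF; rewrite (FP l).2//; last by move=> Flx; apply: nFx; exists l.
  by rewrite ltNge Sl.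
split; first exact: card_le_trans SG GL.
by move=> LS; apply: nLG; exact: card_le_trans LS SG.
Qed.

Lemma co_ideal_nonempty k F : I k F -> exists x, A k x /\ ~ F x.
Proof.
move=> IF; apply: contrapT => nx; apply: (ideal_proper (I_ideal k)).
apply: (ideal_down (I_ideal k) IF) => x Ax; apply: contrapT => nFx.
by apply: nx; exists x.
Qed.

(** The complement of a set of the ideal has more than [|L|] points: otherwise it
    would be a union of at most [|L|] singletons, hence in the ideal, and so would [A k]. *)
Lemma co_ideal_injection k F : I k F ->
  exists2 g : L -> K, injective g & forall l, A k (g l) /\ ~ F (g l).
Proof.
move=> IF; have [LA|AL] := card_le_total [set: L] (A k `\` F).
  have [r [rtot rinj _ rA]] := card_le_rel LA.
  have /choice[g gP] l : exists y, r l y by have [//|y _ rly] := rtot l; exists y.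
  exists g => [l l' e|l]; first by apply: (rinj _ _ (g l)) => //; rewrite e.
  by have [_ []] := rA _ _ (gP l).
exfalso; apply: (ideal_proper (I_ideal k)).
have IAF : I k (A k `\` F).
  have := @ideal_bigcup _ _ _ _ (I_ideal k) ([set [set x] | x in A k `\` F]).
  rewrite bigcup_image bigcup_imset1 image_id; apply.
    by move=> _ [x [Ax _] <-]; exact: ideal_set1.
  exact: card_le_trans (card_image_le _ _) AL.
apply: (ideal_down (I_ideal k) (ideal_setU L_inf I_ideal IAF IF)) => x Ax.
by have [Fx|nFx] := pselect (F x); [right|left].
Qed.

(** The diagonal values at level [k] are almost all a limit of one family at level
    [k - 1]. The limit is unique, because two sets of fewer than [|L|] indices do
    not cover [L]. *)
Lemma diag_ae_const k : exists c : R, exists2 F, I k F &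
  forall x, A k x -> ~ F x -> f (Fin (x, x)) = c.
Proof.
have [g ginj Ag] := co_ideal_injection (k - 1) set0 (ideal_set0 I_ideal _).
have [|F] := diag_cvg_along (k - 1) g ginj; first by move=> l; have [] := Ag l.
rewrite subrK => IF FP; have [x0 [Ax0 nFx0]] := co_ideal_nonempty k F IF.
exists (f (Fin (x0, x0))), F => // x Ax nFx; apply/eqP.
rewrite -subr_eq0 -normr_le0 leNgt.
apply/negP => d0; set d := `|_| in d0.
have d20 : 0 < d / 2 by rewrite divr_gt0.
have [_ []] := card_ltU L_inf (FP _ _ Ax0 nFx0 d20) (FP _ _ Ax nFx d20).
apply: subset_card_le => l _ /=; apply: contrapT => /not_orP[].
move=> /negP; rewrite -ltNge distrC => h0 /negP; rewrite -ltNge => h1.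
suff : d < d by rewrite ltxx.
rewrite {2}[d]splitr; apply: le_lt_trans (ltrD h1 h0).
exact: ler_distD.
Qed.

(** A family of points where [f] has the constant value of level [k] converges to
    that value, which is thus also the constant of level [k + 1]. *)
Lemma diag_ae_const_uniform : exists c : R, forall k, exists2 F, I k F &
  forall x, A k x -> ~ F x -> f (Fin (x, x)) = c.
Proof.
have /choice[c cP] := diag_ae_const.
have cS k : c (k + 1) = c k.
  have [F IF FE] := cP k; have [F' IF' FE'] := cP (k + 1).
  have [g ginj gP] := co_ideal_injection k F IF.
  have [|F'' IF'' FP] := diag_cvg_along k g ginj; first by move=> l; have [] := gP l.
  have [x [Ax /not_orP[nF' nF'']]] :=
    co_ideal_nonempty _ _ (ideal_setU L_inf I_ideal IF' IF'').
  apply/eqP; rewrite -subr_eq0 -normr_le0 leNgt.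
  apply/negP => d0; have [_ []] := FP x _ Ax nF'' d0.
  apply: subset_card_le => l _ /=.
  by have [Agl nFgl] := gP l; rewrite FE'// FE.
exists (c 0) => k; suff <- : c k = c 0 by [].
by elim/int_rect: k => [//|n <-|n <-]; [rewrite intS addrC|
  rewrite -cS; congr c; lia].
Qed.

Lemma continuous_ends_eq : f PInf = f NInf.
Proof.
have [c cP] := diag_ae_const_uniform.
have near_end (t : Xs) : (forall U, open U -> U t ->
    exists k, forall x, A k x -> U (Fin (x, x))) -> f t = c.
  move=> tU; apply/eqP; rewrite -subr_eq0 -normr_le0 leNgt; apply/negP => e0.
  have [U [oU Ut] Uf] := (continuous_openP _ _ f).1 cf t _ e0.
  have [k Uk] := tU U oU Ut; have [F IF FE] := cP k.
  have [x [Ax nFx]] := co_ideal_nonempty _ _ IF.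
  by have := Uf _ (Uk x Ax); rewrite FE// ltxx.
rewrite !near_end// => U /ext_openP[_ UP UN] Ut.
  have [m mU] := UN Ut; exists (m - 1) => x Ax; apply: mU; right.
  exists (x, x) => //; split; first by exists (m - 1) => //=; lia.
  by move=> [_ [/= Amx _]]; have := part_uniq A_part Ax Amx; lia.
have [m mU] := UP Ut; exists (m + 1) => x Ax; apply: mU; right.
by exists (x, x) => //; exists (m + 1) => //=; lia.
Qed.

End ContinuousFunction.

End Space.

Theorem mainTheorem1 (R : realType) (K L : Type)
  (L_inf : infinite_set [set: L])
  (L_lt_K : [set: L] #< [set: K])
  (K_unc : ~ countable [set: K])
  (A : int -> set K)
  (A_part : partition [set: int] A [set: K])
  (A_card : forall k, A k #= [set: K])
  (I : int -> set (set K))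
  (I_ideal : forall k, proper_complete_ideal L (A k) (I k)) :
  let X := two_point_ext L_inf A_part I_ideal in
  [/\ T1_regular X /\ ~ T1_completely_regular X R,
      T1_regular (set_type (~` [set (PInf : X)])) /\
        ~ T1_completely_regular (set_type (~` [set (PInf : X)])) R,
      T1_regular (set_type (~` [set (NInf : X)])) /\
        ~ T1_completely_regular (set_type (~` [set (NInf : X)])) R &
      forall f : X -> R, continuous f -> f PInf = f NInf].
Proof.
move=> X; have regX : T1_regular X.
  by split; [exact: accessible_ext|exact: regular_ext].
have ends (f : X -> R) : continuous f -> f PInf = f NInf.
  exact: continuous_ends_eq.
have ends' (f : X -> R) : continuous f -> f NInf = f PInf by move=> /ends.
have PN : (PInf : X) <> NInf by [].
have NP : (NInf : X) <> PInf by [].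
split=> //; split=> //; try exact: T1_regular_subtype.
- exact: indist_not_completely_regular PN ends.
- exact: indist_sub_not_completely_regular PN ends.
- exact: indist_sub_not_completely_regular NP ends'.
Qed.
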